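(* Let $k\geq 2$ be an integer. There exists a connected $k$-regular multigraph $G$ of order $k^2-k+1$ (loops and multiple edges allowed) with only $3$ distinct eigenvalues if and only if there exists a finite projective plane of order $k-1$ that admits a polarity.
   Context: A multigraph $G=(V,E)$ is finite and undirected, and may have multiple edges and loops. For $u,v\in V$, $m(u,v)$ is the number of edges between $u$ and $v$ if $u\neq v$, and the number of loops on $u$ if $u=v$. The order of $G$ is $|V|$. The adjacency matrix of $G$ is the symmetric matrix $A$ indexed by $V$ with $(u,v)$-entry $m(u,v)$ (so each loop contributes $1$ to the diagonal). $G$ is $k$-regular if $\sum_{v\in V} m(u,v)=k$ for each $u\in V$ (so each loop contributes $1$ to the degree). The eigenvalues of $G$ are the eigenvalues of $A$; ''only 3 distinct eigenvalues'' means that $A$ has exactly three distinct eigenvalues. For an integer $q\ge 1$, a finite projective plane of order $q$ is a point-line geometry $(\mathcal{P},\mathcal{L})$ with $|\mathcal{P}|=|\mathcal{L}|=q^2+q+1$, such that each line contains exactly $q+1$ points, there are exactly $q+1$ lines through each point, and any two distinct points lie on exactly one common line. (It is not required to be Desarguesian; for $q=1$ this is the triangle.) A polarity of $(\mathcal{P},\mathcal{L})$ is an isomorphism $\varphi$ from $(\mathcal{P},\mathcal{L})$ to the dual plane $(\mathcal{L},\mathcal{P})$ that is an involution; that is, $\varphi$ is a bijection of $\mathcal{P}\cup\mathcal{L}$ interchanging $\mathcal{P}$ and $\mathcal{L}$, with $\varphi^2=\mathrm{id}$, such that a point $p$ lies on a line $l$ if and only if the point $\varphi(l)$ lies on the line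 $\varphi(p)$. The plane admits a polarity if such a $\varphi$ exists. *)

(* Defs.v *)
From HB Require Import structures.
From mathcomp Require Import all_boot all_order all_algebra all_field.

Set Implicit Arguments.
Unset Strict Implicit.
Unset Printing Implicit Defensive.

Import GRing.Theory.

(* The endpoint set of an edge has two elements, or one when the edge is a
   loop; distinct edges may have the same endpoint set. *)
Record multigraph := Multigraph {
  vertex : finType;
  edge : finType;
  endpoints : edge -> {set vertex};
  endpoints_card : forall e, 0 < #|endpoints e| <= 2
}.

(* For u = v the set [set u; v] is a singleton, so this counts loops on u. *)
Definition multiplicity (G : multigraph) (u v : vertex G) : nat :=
  #|[set e : edge G | endpoints e == [set u; v]]|.

Definition connected_multigraph (G : multigraph) : Prop :=
  forall u v : vertex G,
    connect [rel x y : vertex G | 0 < multiplicity x y] u v.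

(* A loop contributes 1 to the degree of its vertex. *)
Definition regular_multigraph (k : nat) (G : multigraph) : Prop :=
  forall u : vertex G, \sum_(v : vertex G) multiplicity u v = k.

(* MathComp matrices are indexed by ordinals, hence the enumeration of the
   vertices. Complex eigenvalues of an integer matrix are algebraic, so none
   is lost by taking algC as the ground field. *)
Definition adjacency_matrix (G : multigraph) : 'M[algC]_#|vertex G| :=
  \matrix_(i, j) (multiplicity (enum_val i) (enum_val j))%:R%R.

Definition has_distinct_eigenvalues (F : fieldType) (n : nat) (A : 'M[F]_n)
    (d : nat) : Prop :=
  exists s : seq F, [/\ uniq s, size s = d & eigenvalue A =i s].

Record geometry := Geometry {
  point : finType;
  line : finType;
  incident : point -> line -> bool
}.

Definition dual_geometry (Pi : geometry) : geometry :=
  Geometry (fun (l : line Pi) (p : point Pi) => incident p l).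

Definition projective_plane (q : nat) (Pi : geometry) : Prop :=
  [/\ 0 < q,
      #|point Pi| = q ^ 2 + q + 1 /\ #|line Pi| = q ^ 2 + q + 1,
      forall l : line Pi, #|[set p : point Pi | incident p l]| = q + 1,
      forall p : point Pi, #|[set l : line Pi | incident p l]| = q + 1
    & forall p1 p2 : point Pi, p1 != p2 ->
        exists! l : line Pi, incident p1 l /\ incident p2 l].

Definition geometry_isomorphism (Pi1 Pi2 : geometry)
    (f : point Pi1 -> point Pi2) (g : line Pi1 -> line Pi2) : Prop :=
  [/\ bijective f, bijective g
    & forall (p : point Pi1) (l : line Pi1),
        incident p l = incident (f p) (g l)].

(* A bijection phi of the disjoint union of points and lines that interchanges
   the two parts is given by its restrictions f and g; phi \o phi = id says
   that f and g are mutually inverse. *)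
Definition polarity (Pi : geometry)
    (f : point Pi -> line Pi) (g : line Pi -> point Pi) : Prop :=
  [/\ @geometry_isomorphism Pi (dual_geometry Pi) f g,
      cancel f g & cancel g f].

Definition admits_polarity (Pi : geometry) : Prop :=
  exists (f : point Pi -> line Pi) (g : line Pi -> point Pi), polarity f g.

(* Main.v *)
Require Import Defs.
From mathcomp Require Import all_boot all_order all_algebra all_field.
From mathcomp Require Import zify ring.

(* If the adjacency matrix A has eigenvalues k, x, y, then the columns of
   (A - x)(A - y) are harmonic, hence constant by connectedness, so
   A^2 = a A + b I + c J. For k >= 3 a pair of nonadjacent vertices shows that
   c is a positive integer, and an adjacent pair that a is rational. Comparing
   diagonal entries with the order k^2 - k + 1 rules out a > 0, and also a < 0,
   leaving a = 0 and c = 1: A is a 0/1 matrix with A^2 = (k - 1) I + J, the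
   incidence matrix of a plane whose i-th line is the polar of its i-th point.
   Conversely such an A has eigenvalues k and +-sqrt (k - 1), and both signs
   occur as soon as A has a zero entry off the diagonal. For k = 2 both sides
   hold. *)

Set Implicit Arguments.
Unset Strict Implicit.
Unset Printing Implicit Defensive.
Import GRing.Theory Num.Theory Order.TTheory.
Local Open Scope ring_scope.

(** * Weighted adjacency matrices, two-step walks and harmonic functions *)

(** For [w] the multiplicity of a multigraph this is convertible to its adjacency matrix; general
    weights also cover relations, read as 0/1 weights. *)
Definition weight_mx (V : finType) (w : V -> V -> nat) : 'M[algC]_#|V| :=
  \matrix_(i, j) (w (enum_val i) (enum_val j))%:R.

Definition walks2 (V : finType) (w : V -> V -> nat) (u v : V) : nat :=
  \sum_t w u t * w t v.

Lemma weight_mx_sqr (V : finType) (w : V -> V -> nat) (i j : 'I_#|V|) :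
  (weight_mx w *m weight_mx w) i j
    = (walks2 w (enum_val i) (enum_val j))%:R.
Proof.
rewrite mxE natr_sum [RHS](big_enum_val (A := V)) /=.
by apply: eq_bigr => l _; rewrite !mxE natrM.
Qed.

Lemma walks2_sym (V : finType) (w : V -> V -> nat) (u v : V) :
  (forall x y, w x y = w y x) -> walks2 w u v = walks2 w v u.
Proof.
by move=> wC; apply: eq_bigr => t _; rewrite mulnC (wC t v) (wC u t).
Qed.

Lemma walks2_rowsum (V : finType) (w : V -> V -> nat) (k : nat) (u : V) :
  (forall x, \sum_y w x y = k)%N -> (\sum_v walks2 w u v = k ^ 2)%N.
Proof.
move=> wk; rewrite exchange_big /= -mulnn -{1}(wk u) big_distrl /=.
by apply: eq_bigr => t _; rewrite -big_distrr /= wk.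
Qed.

(* Summation by parts: the Dirichlet form [\sum w u v * `|g u - g v| ^+ 2]
   vanishes. *)
Lemma harmonic_constant (V : finType) (w : V -> V -> nat) (k : nat)
    (g : V -> algC) :
  (forall x y, w x y = w y x) -> (forall x, \sum_y w x y = k)%N ->
  (forall x y, connect [rel x y : V | (0 < w x y)%N] x y) ->
  (forall x, \sum_y (w x y)%:R * g y = k%:R * g x) ->
  forall x y, g x = g y.
Proof.
move=> wC wk wconn gk.
pose d x y := (w x y)%:R * `|g x - g y| ^+ 2.
have d_ge0 x y : 0 <= d x y by rewrite mulr_ge0 ?ler0n ?exprn_ge0.
have lap0 x : \sum_y (w x y)%:R * (g x - g y) = 0.
  under eq_bigr do rewrite mulrBr.
  by rewrite big_split /= sumrN gk -mulr_suml -natr_sum wk subrr.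
have sum0 : \sum_x \sum_y d x y = 0.
  transitivity (\sum_x \sum_y (w x y)%:R * (g x - g y) * (g x)^*
                + \sum_y \sum_x (w y x)%:R * (g y - g x) * (g y)^*).
    rewrite [X in _ = _ + X]exchange_big -big_split /=; apply: eq_bigr => x _.
    rewrite -big_split /=; apply: eq_bigr => y _.
    by rewrite /d normCK rmorphB (wC y x); ring.
  rewrite !big1 ?addr0 // => x _; rewrite -mulr_suml lap0 ?mul0r //.
have d0 x y : d x y = 0.
  have /psumr_eq0P := sum0.
  move=> /(_ (fun i _ => sumr_ge0 _ (fun j _ => d_ge0 i j)))/(_ x isT).
  by move/psumr_eq0P; apply.
have adj x y : (0 < w x y)%N -> g x = g y.
  move=> wxy; have /eqP := d0 x y; rewrite mulf_eq0 pnatr_eq0 (gtn_eqF wxy) /=.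
  by rewrite sqrf_eq0 normr_eq0 subr_eq0 => /eqP.
move=> x y; have /connectP[p xp ->] := wconn x y.
elim: p x xp => //= z p IH x /andP[xz /IH <-]; exact: adj.
Qed.

(** * From three eigenvalues to a quadratic equation for A *)

(** A normal matrix has a basis of eigenvectors, the rows of [P], and each of them is killed by one
    of the three factors. *)
Lemma normal_cubic (C : numClosedFieldType) (n : nat) (A : 'M[C]_n)
    (x y z : C) :
  A \is normalmx -> {subset eigenvalue A <= [:: x; y; z]} ->
  (A - x%:M) *m (A - y%:M) *m (A - z%:M) = 0.
Proof.
move=> /orthomx_spectralP; set P := spectralmx A; set D := spectral_diag A.
have Pu : P \in unitmx by apply: spectral_unit.
move=> AE eigA.
have PA : P *m A = diag_mx D *m P.
  by have := congr1 (mulmx P) AE; rewrite !mulmxA mulmxV // mul1mx.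
have rowA i : row i P *m A = D 0 i *: row i P.
  by rewrite -row_mul PA row_mul row_diag_mx -scalemxAl -rowE.
have row_neq0 i : row i P != 0.
  have: row_free P by rewrite row_free_unit.
  move=> /row_freeP[B PB]; apply/eqP => Pi0; have := congr1 (row i) PB.
  rewrite row_mul Pi0 mul0mx row1 => /rowP/(_ i)/eqP.
  by rewrite !mxE !eqxx eq_sym oner_eq0.
have rowB i a : row i P *m (A - a%:M) = (D 0 i - a) *: row i P.
  by rewrite mulmxBr rowA mul_mx_scalar scalerBl.
apply: (can_inj (mulKmx Pu)); rewrite mulmx0; apply/row_matrixP => i.
rewrite row0 row_mul !mulmxA !(rowB, =^~ scalemxAl) !scalerA.
have : D 0 i \in eigenvalue A by apply/eigenvalueP; exists (row i P).
move=> /eigA; rewrite !inE => /or3P[]/eqP->;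
by rewrite subrr ?(mul0r, mulr0) scale0r.
Qed.

Lemma walks2_three_eigenvalues (V : finType) (w : V -> V -> nat) (k : nat)
    (u0 : V) :
  (forall x y, w x y = w y x) -> (forall x, \sum_y w x y = k)%N ->
  (forall x y, connect [rel x y : V | (0 < w x y)%N] x y) ->
  has_distinct_eigenvalues (weight_mx w) 3 ->
  exists a b c : algC, c != 0 /\ forall u v,
    (walks2 w u v)%:R = a * (w u v)%:R + b * (u == v)%:R + c.
Proof.
move=> wC wk wconn [s [s_uniq s_size eigA]]; set A := weight_mx w in eigA.
(* Regularity makes the all-ones vector an eigenvector for k. *)
have ks : k%:R \in s.
  rewrite -eigA; apply/eigenvalueP; exists (const_mx 1).
    apply/rowP => j; rewrite !mxE mulr1 -(wk (enum_val j)) natr_sum.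
    rewrite [RHS](big_enum_val (A := V)) /=; apply: eq_bigr => i _.
    by rewrite !mxE mul1r wC.
  by apply/eqP => /rowP/(_ (enum_rank u0))/eqP; rewrite !mxE oner_eq0.
have [x [y [xk yk sE]]] : exists x y, [/\ x != k%:R, y != k%:R
    & s =i [:: k%:R; x; y]].
  move: (perm_to_rem ks) => sp; have := perm_size sp; rewrite s_size /=.
  have := sp; case: (rem _ s) => [|x [|y [|]]] // /[dup] /perm_mem sE.
  move=> sp' _; exists x, y; split => //.
    by have := perm_uniq sp'; rewrite s_uniq /= !inE eq_sym; case: eqVneq.
  by have := perm_uniq sp'; rewrite s_uniq /= !inE (eq_sym y);
    case: (k%:R =P y); rewrite ?orbT.
have An : A \is normalmx.
  apply: symmetric_normalmx.
    apply/is_hermitianmxP; rewrite expr0 scale1r; apply/matrixP => i j.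
    by rewrite !mxE wC.
  by apply/mxOverP => i j; rewrite !mxE realn.
have A0 : (A - k%:R%:M) *m ((A - x%:M) *m (A - y%:M)) = 0.
  by rewrite mulmxA; apply: normal_cubic => // a; rewrite -sE -eigA.
set M := _ *m (A - y%:M) in A0.
have ME i j : M i j = (walks2 w (enum_val i) (enum_val j))%:R
   - (x + y) * (w (enum_val i) (enum_val j))%:R + x * y * (i == j)%:R.
  rewrite /M mulmxBr !mulmxBl mul_mx_scalar mul_scalar_mx -scalar_mxM.
  have := weight_mx_sqr w i j; rewrite -/A !mxE => ->.
  by rewrite mulr_natr; ring.
have MC i j : M i j = M j i.
  by rewrite !ME (walks2_sym _ _ wC) (wC (enum_val j)) (eq_sym i).
have Mcol j u v : M (enum_rank u) j = M (enum_rank v) j.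
  apply: (harmonic_constant (g := fun u => M (enum_rank u) j) wC wk wconn) => t.
  have /matrixP/(_ (enum_rank t) j) := A0; rewrite mulmxBl mul_scalar_mx !mxE.
  move/eqP; rewrite subr_eq0 => /eqP <-.
  rewrite [LHS](big_enum_val (A := V)) /=; apply: eq_bigr => i _.
  by rewrite !mxE enum_valK enum_rankK.
(* Constant columns and symmetry make all entries of [M] equal. *)
pose c := M (enum_rank u0) (enum_rank u0).
have Mc u v : M (enum_rank u) (enum_rank v) = c.
  by rewrite (Mcol _ _ u0) MC (Mcol _ _ u0).
have SE u v : (walks2 w u v)%:R =
    (x + y) * (w u v)%:R + (- x * y) * (u == v)%:R + c.
  rewrite -(Mc u v) ME !enum_rankK (inj_eq enum_rank_inj); ring.
exists (x + y), (- x * y), c; split=> //.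
(* With c = 0, summing row [u0] gives k^2 = (x + y) k - x y, that is (k - x)(k - y) = 0, although x
   and y differ from k. *)
apply/eqP => c0.
have : \sum_v ((walks2 w u0 v)%:R : algC) = (x + y) * k%:R - x * y.
  under eq_bigr do rewrite SE c0 addr0.
  rewrite big_split /= -!mulr_sumr -natr_sum wk (bigD1 u0) //= eqxx.
  by rewrite big1 ?addr0 ?mulr1 ?mulNr // => v; rewrite eq_sym => /negPf->.
rewrite -natr_sum (walks2_rowsum _ wk) natrX => /eqP; rewrite -subr_eq0.
have -> : k%:R ^+ 2 - ((x + y) * k%:R - x * y)
    = (k%:R - x) * (k%:R - y) by ring.
by rewrite mulf_eq0 !subr_eq0 !(eq_sym k%:R) (negPf xk) (negPf yk).
Qed.

(** * Integrality and the arithmetic of the coefficients *)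

(** The entry at [u1], [v1] gives c, a number of walks; then the entry at [u0], [v0] gives a, and
    the diagonal entry at [u0] gives b, both up to the factor [w u0 v0]. Multiplying by this factor
    clears denominators. *)
Lemma walks2_integral_coefficients (V : finType) (w : V -> V -> nat)
    (a b c : algC) (u0 v0 u1 v1 : V) :
  c != 0 ->
  (forall u v, (walks2 w u v)%:R = a * (w u v)%:R + b * (u == v)%:R + c) ->
  u0 != v0 -> u1 != v1 -> w u1 v1 = 0%N ->
  exists (p q : int) (l : nat), (0 < l)%N /\ forall u v,
    (w u0 v0 * walks2 w u v)%:Z
      = p * (w u v)%:Z + q * (u == v)%:Z + (w u0 v0 * l)%:Z.
Proof.
move=> c0 wE uv0 uv1 w1.
have cE : c = (walks2 w u1 v1)%:R.
  by rewrite wE w1 (negPf uv1) !mulr0 !add0r.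
have aE : (w u0 v0)%:R * a = (walks2 w u0 v0)%:R - (walks2 w u1 v1)%:R.
  by rewrite wE -cE (negPf uv0) mulr0; ring.
have bE : (w u0 v0)%:R * b = (w u0 v0)%:R * (walks2 w u0 u0)%:R
   - ((walks2 w u0 v0)%:R - (walks2 w u1 v1)%:R) * (w u0 u0)%:R
   - (w u0 v0)%:R * (walks2 w u1 v1)%:R.
  by rewrite -aE -cE (wE u0 u0) eqxx mulr1; ring.
pose p : int := (walks2 w u0 v0)%:Z - (walks2 w u1 v1)%:Z.
pose q : int := (w u0 v0)%:Z * (walks2 w u0 u0)%:Z - p * (w u0 u0)%:Z
                - (w u0 v0)%:Z * (walks2 w u1 v1)%:Z.
exists p, q, (walks2 w u1 v1); split.
  by rewrite lt0n; apply: contraNneq c0 => S0; rewrite cE S0.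
move=> u v; apply: (@intr_inj algC).
rewrite PoszM intrM -!pmulrn wE mulrDr mulrDr !mulrA aE bE.
rewrite /q /p !(rmorphD, rmorphB, rmorphM, rmorphN) /= -!pmulrn cE.
by [].
Qed.

(** The handshake argument: the entries at (x, y) and (y, x) pair up, with [enum_rank] ordering each
    pair. *)
Lemma even_sum_symmetric (V : finType) (w : V -> V -> nat) :
  (forall x y, w x y = w y x) -> (forall x, w x x = 0%N) ->
  ~~ odd (\sum_x \sum_y w x y).
Proof.
move=> wC w0; pose r (x y : V) := (enum_rank x < enum_rank y)%N.
have -> : (\sum_x \sum_y w x y =
           \sum_x \sum_(y | r x y) w x y + \sum_x \sum_(y | r y x) w x y)%N.
  rewrite -big_split; apply: eq_bigr => x _ /=.
  rewrite (bigID (r x)) /=; congr addn.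
  rewrite (bigD1 x) /= ?ltnn ?w0 ?add0n; last by rewrite /r ltnn.
  apply: eq_bigl => y; rewrite /r -leqNgt ltn_neqAle andbC; congr (_ && _).
  by rewrite (inj_eq val_inj) (inj_eq enum_rank_inj).
rewrite [X in (_ + X)%N](exchange_big_dep predT) //=.
rewrite [X in (_ + X)%N](eq_bigr (fun x => \sum_(y | r x y) w x y)%N);
  last first.
  by move=> x _; apply: eq_bigr => y _; exact: wC.
by rewrite addnn odd_double.
Qed.

Lemma walks2_diag (V : finType) (w : V -> V -> nat) (u : V) :
  (forall x y, w x y = w y x) -> walks2 w u u = (\sum_v w u v ^ 2)%N.
Proof. by move=> wC; apply: eq_bigr => v _; rewrite (wC v) mulnn. Qed.

Lemma leq_walks2 (V : finType) (w : V -> V -> nat) (u t v : V) :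
  (w u t * w t v <= walks2 w u v)%N.
Proof. by rewrite /walks2 (bigD1 t) //= leq_addr. Qed.

(* With p > 0 the diagonal forces k <= w u u; with p < 0 and l = 1 all
   nonzero weights would equal a root t of t ^ 2 = t + 1; with p < 0 and
   l >= 2 the only solution would be a loopless cubic graph on 7 vertices. *)
Lemma walks2_design (V : finType) (w : V -> V -> nat) (k m l : nat)
    (p q : int) :
  (forall x y, w x y = w y x) -> (forall x, \sum_y w x y = k)%N ->
  (2 < k)%N -> #|V| = (k ^ 2 - k + 1)%N ->
  (forall u, exists2 v, v != u & (0 < w u v)%N) ->
  (0 < m)%N -> (0 < l)%N ->
  (forall u v, (m * walks2 w u v)%:Z
      = p * (w u v)%:Z + q * (u == v)%:Z + (m * l)%:Z) ->
  (forall u v, w u v <= 1)%N /\ (forall u v, u != v -> walks2 w u v = 1%N).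
Proof.
move=> wC wk k_gt2 nE nbr m_gt0 l_gt0 wE.
have [u0 _] : exists u : V, true.
  have /card_gt0P[u _] : (0 < #|V|)%N by rewrite nE addn1.
  by exists u.
have diag_ge u : (k <= walks2 w u u)%N.
  by rewrite walks2_diag // -(wk u) leq_sum // => v _;
    case: (w u v) => // n; rewrite -mulnn leq_pmulr.
have loop_lt u : (w u u < k)%N.
  have [v vu wuv] := nbr u; rewrite -(wk u) (bigD1 u) //= (bigD1 v) //=; lia.
have tot : (m * k ^ 2)%:Z = p * k%:Z + q + (m * l)%:Z * (k%:Z ^+ 2 - k%:Z + 1).
  rewrite -(walks2_rowsum u0 wk) big_distrr /= (big_morph Posz PoszD (erefl _)).
  under eq_bigr do rewrite wE.
  rewrite !big_split /= -!mulr_sumr -(big_morph Posz PoszD (erefl _)) wk.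
  rewrite (bigD1 u0) //= eqxx big1 ?addr0 ?mulr1; last first.
    by move=> v; rewrite eq_sym => /negPf->.
  by rewrite sumr_const cardT -cardE nE; nia.
(* Subtracting [tot] from the diagonal equation eliminates q. *)
have diag u :
  m%:Z * ((walks2 w u u)%:Z - k%:Z) + m%:Z * (k%:Z ^+ 2 - k%:Z) * (l%:Z - 1)
    = p * ((w u u)%:Z - k%:Z).
  by have := wE u u; rewrite eqxx mulr1 !PoszM; nia.
have offdiag u v : u != v ->
    m%:Z * (walks2 w u v)%:Z = p * (w u v)%:Z + m%:Z * l%:Z.
  by move=> /negPf uv; rewrite -!PoszM wE uv mulr0 addr0.
have K0 : 0 < k%:Z ^+ 2 - k%:Z :> int by nia.
have S_ge u : 0 <= m%:Z * ((walks2 w u u)%:Z - k%:Z) by have := diag_ge u; nia.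
have [v0 v0u w0] := nbr u0.
have off0 : m%:Z * (walks2 w u0 v0)%:Z = p * (w u0 v0)%:Z + m%:Z * l%:Z.
  by apply: offdiag; rewrite eq_sym.
have [p_gt0|p_lt0|p0] := ltrgtP 0 p.
- exfalso; have := loop_lt u0; have := S_ge u0; have := diag u0.
  have : 0 <= m%:Z * (k%:Z ^+ 2 - k%:Z) * (l%:Z - 1).
    by apply: mulr_ge0; [apply: mulr_ge0|]; lia.
  by nia.
- exfalso; have [l1|l2] : l = 1%N \/ (2 <= l)%N by lia.
  + subst l.
    (* For adjacent u and v the right side of [offdiag] is p w + m < m, so the walk count is 0. *)
    have adj u v : u != v -> (0 < w u v)%N ->
        p * (w u v)%:Z = - m%:Z /\ walks2 w u v = 0%N.
      move=> uv wuv; have := offdiag u v uv.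
      by case: (walks2 w u v) => [|s]; [lia | nia].
    have loop0 u : w u u = 0%N.
      have [v vu wuv] := nbr u.
      have [|_ S0] := adj u v _ wuv; first by rewrite eq_sym.
      by have := leq_walks2 w u u v; rewrite S0; nia.
    have [pt _] : p * (w u0 v0)%:Z = - m%:Z /\ walks2 w u0 v0 = 0%N.
      by apply: adj => //; rewrite eq_sym.
    have pS : p * (walks2 w u0 u0)%:Z = - m%:Z * k%:Z.
      rewrite walks2_diag // -(wk u0) !(big_morph Posz PoszD (erefl _)).
      rewrite !mulr_sumr; apply: eq_bigr => v _.
      have [<-|uv] := eqVneq u0 v; first by rewrite loop0 !mulr0.
      case: (posnP (w u0 v)) => [->|wv]; first by rewrite !mulr0.
      by have [] := adj u0 v uv wv; nia.
    (* Put t = [w u0 v0], so p t = - m. Then [diag] divided by k reads m (t - 1) = - p, and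
       multiplying by t gives t (t - 1) = 1. *)
    have St : (walks2 w u0 u0)%:Z = (w u0 v0)%:Z * k%:Z by nia.
    have := diag u0; rewrite St loop0 subrr mulr0 addr0 => E.
    have E1 : m%:Z * ((w u0 v0)%:Z - 1) = - p by nia.
    have : (w u0 v0)%:Z * ((w u0 v0)%:Z - 1) = 1 by nia.
    by case: (w u0 v0) => [|[|t]] ; nia.
  + have p_le : - p <= m%:Z * l%:Z by nia.
    have loop_le u :
        (k%:Z ^+ 2 - k%:Z) * (l%:Z - 1) <= l%:Z * (k%:Z - (w u u)%:Z).
      by have := loop_lt u; have := S_ge u; have := diag u; nia.
    (* Dividing [loop_le] by k gives (k - 1)(l - 1) <= l. At k = 3, l = 2 the bound is tight, which
       forbids loops; the total weight 3 * 7 is then odd. *)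
    have [k3 l2'] : k = 3%N /\ l = 2%N by have := loop_le u0; nia.
    have loop0 u : w u u = 0%N by have := loop_le u; rewrite k3 l2'; lia.
    have := even_sum_symmetric wC loop0.
    by under eq_bigr do rewrite wk; rewrite sum_nat_const nE k3.
- have base u : walks2 w u u = k /\ l = 1%N.
    have := S_ge u; have := diag u; rewrite -p0 mul0r.
    have := diag_ge u; set s := walks2 w u u => s_ge E _.
    have l1 : l = 1%N.
      apply/eqP; rewrite eqn_leq l_gt0 andbT leqNgt; apply/negP => l2.
      suff : 0 < m%:Z * (k%:Z ^+ 2 - k%:Z) * (l%:Z - 1) by nia.
      by apply: mulr_gt0; [apply: mulr_gt0|]; lia.
    by split=> //; move: E; rewrite l1 subrr mulr0 addr0; nia.
  have [_ l1] := base u0; subst l.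
  split=> [u v|u v uv]; last by have := offdiag u v uv; rewrite -p0; nia.
  rewrite leqNgt; apply/negP => w2.
  (* Both sums equal k, but an entry at least 2 makes the sum of squares larger. *)
  have : (\sum_v w u v < \sum_v w u v ^ 2)%N.
    rewrite (bigD1 v) //= [X in (_ < X)%N](bigD1 v) //= -addSn.
    rewrite leq_add //; first by nia.
    by apply: leq_sum => t _; case: (w u t) => // n; rewrite -mulnn leq_pmulr.
  by rewrite -walks2_diag // wk; case: (base u) => ->; rewrite ltnn.
Qed.

(** * Polar relations and planes with a polarity *)

(* The relation "u lies on the polar line of v" of a polarity of a plane of
   order k - 1. *)
Definition polar_relation (V : finType) (k : nat) (r : rel V) : Prop :=
  [/\ symmetric r, #|V| = (k ^ 2 - k + 1)%N,
      forall x, #|[set y | r x y]| = k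
    & forall u v, u != v -> exists! t, r u t /\ r v t].

(** [V] serves both as points and as lines; since [r] is symmetric, the identity is a polarity. *)
Lemma plane_of_polar_relation (V : finType) (k : nat) (r : rel V) :
  (2 <= k)%N -> polar_relation k r ->
  exists Pi : geometry, projective_plane (k - 1) Pi /\ admits_polarity Pi.
Proof.
move=> k2 [rC nE rk rT]; exists (@Geometry V V r); split.
  have kE : (k - 1 + 1 = k)%N by lia.
  split; rewrite ?kE //=; first by lia.
  - by rewrite nE; split; nia.
  - by move=> l; rewrite -(rk l); apply: eq_card => x; rewrite !inE rC.
exists id, id; split=> //; split=> [||p l]; first by exists id.
  by exists id.
exact: rC.
Qed.

Lemma polar_relation_of_plane (k : nat) (Pi : geometry) :
  (2 <= k)%N -> projective_plane (k - 1) Pi -> admits_polarity Pi ->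
  exists r : rel (point Pi), polar_relation k r.
Proof.
move=> k2 [_ [nE _] _ pk pT] [f [g [[_ _ fgI] fK gK]]].
exists (fun x y => incident x (f y)); split.
- by move=> x y; rewrite fgI /= fK.
- by rewrite nE; nia.
- move=> x; transitivity (k - 1 + 1)%N; last by lia.
  rewrite -(pk x) -(card_imset _ (can_inj gK)) (can2_imset_pre _ gK fK).
  by apply: eq_card => y; rewrite !inE.
(* The common neighbour of two points is the pole of the line joining them. *)
- move=> u v /pT[l [[ul vl] lU]]; exists (g l); split; first by rewrite gK.
  by move=> t /lU ->; rewrite fK.
Qed.

(* The relation [i != j] would not do: the triangle without loops has only two
   distinct eigenvalues. *)
Lemma polar_relation_order1 :
  exists r : rel 'I_3, polar_relation 2 r /\ exists u v, u != v /\ ~~ r u v.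
Proof.
exists (fun i j => (i + j) %% 3 != 0)%N; split; last first.
  by exists (Ordinal (isT : 1 < 3)%N), (Ordinal (isT : 2 < 3)%N).
split.
- by move=> i j; rewrite addnC.
- by rewrite card_ord.
- case=> [[|[|[|]]]] // ?;
  by rewrite cardsE -sum1_card !big_mkcond !big_ord_recl big_ord0 /= ?unfold_in.
(* The residues missed by u and v are - u and - v; three distinct residues sum to 0 mod 3, so the
   remaining one is u + v. *)
- move=> u v uv; exists (Ordinal (ltn_pmod (u + v) (isT : 0 < 3)%N)).
  have {}uv : (u : nat) <> v by move/val_inj/eqP; apply/negP.
  have [u3 v3] := (ltn_ord u, ltn_ord v).
  split=> [|t [ut vt]]; first by split=> /=; lia.
  by apply/val_inj => /=; have := ltn_ord t; lia.
Qed.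

(** * The spectrum of a polar relation *)

(** Entrywise form of A^2 = (k - 1) I + J. *)
Lemma polar_relation_walks2 (V : finType) (k : nat) (r : rel V) (u v : V) :
  polar_relation k r -> walks2 r u v = if u == v then k else 1%N.
Proof.
case=> rC _ rk rT.
have -> : walks2 r u v = #|[set t | r u t && r v t]|.
  rewrite cardsE -sum1_card [RHS]big_mkcond; apply: eq_bigr => t _ /=.
  by rewrite (rC t v) unfold_in mulnb; case: (_ && _).
case: eqVneq => [<-|/rT[t [[ut vt] tU]]].
  by rewrite -(rk u); apply: eq_card => t; rewrite !inE andbb.
apply/eqP/cards1P; exists t; apply/setP => s; rewrite !inE.
apply/andP/eqP => [[us vs]|-> //]; by rewrite (tU s).
Qed.

Lemma polar_relation_row_sum (V : finType) (k : nat) (r : rel V) (u : V) :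
  polar_relation k r -> (\sum_v r u v = k)%N.
Proof.
case=> _ _ rk _; rewrite -(rk u) cardsE -sum1_card [RHS]big_mkcond.
by apply: eq_bigr => v _; rewrite unfold_in; case: (r u v).
Qed.

(** A vertex and its neighbours number at most k + 1, which is less than k^2 - k + 1 for k > 2. *)
Lemma polar_relation_nonadjacent (V : finType) (k : nat) (r : rel V) :
  (2 < k)%N -> polar_relation k r -> exists u v, u != v /\ ~~ r u v.
Proof.
move=> k2 [_ nE rk _].
have /card_gt0P[u _] : (0 < #|V|)%N by rewrite nE addn1.
have : ~~ ([set: V] \subset u |: [set y | r u y]).
  apply/negP => /subset_leq_card; rewrite cardsT nE cardsU1 rk.
  by case: (_ \notin _); nia.
case/subsetPn => v _; rewrite !inE negb_or eq_sym => /andP[uv ruv].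
by exists u, v.
Qed.

Lemma polar_relation_eigenvalues (V : finType) (k : nat) (r : rel V) (u v : V) :
  (2 <= k)%N -> polar_relation k r -> u != v -> ~~ r u v ->
  has_distinct_eigenvalues (weight_mx r) 3.
Proof.
move=> k2 rP uv ruv; set A := weight_mx r.
pose J : 'M[algC]_#|V| := const_mx 1; pose e : 'rV[algC]_#|V| := const_mx 1.
pose q : algC := (k - 1)%:R; pose s := sqrtC q.
have qE : q = k%:R - 1 by rewrite /q natrB // ltnW.
have ss : s ^+ 2 = q by rewrite sqrtCK.
have s0 : s != 0 by rewrite sqrtC_eq0 pnatr_eq0; lia.
have kneq x : x ^+ 2 = q -> k%:R != x.
  move=> xq; apply: contra_eq_neq xq => <-; rewrite -natrX eqr_nat; nia.
have AA : A *m A = q%:M + J.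
  apply/matrixP => i j.
  rewrite weight_mx_sqr (polar_relation_walks2 _ _ rP) !mxE.
  rewrite (inj_eq enum_val_inj); case: eqP => _; last by rewrite add0r.
  by rewrite qE mulr1n; ring.
have eA : e *m A = k%:R *: e.
  have [rC _ _ _] := rP.
  apply/rowP => j; rewrite !mxE mulr1 -(polar_relation_row_sum (enum_val j) rP).
  rewrite natr_sum [RHS](big_enum_val (A := V)) /=; apply: eq_bigr => i _.
  by rewrite !mxE mul1r rC.
have eJ (x : 'rV_#|V|) : exists c, x *m J = c *: e.
  exists (\sum_i x 0 i); apply/rowP => j; rewrite !mxE mulr1.
  by apply: eq_bigr => i _; rewrite !mxE mulr1.
have root_eig x : x ^+ 2 = q -> eigenvalue A x.
  (* As (A + x)(A - x) = J and (A - k) J = 0, every nonzero row of [B] is an eigenvector for x. Row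
     [u] is nonzero: its entry at [v] is 1, coming from A^2 alone. *)
  move=> xq; pose B := (A - k%:R%:M) *m (A + x%:M).
  have AkJ : (A - k%:R%:M) *m J = 0.
    apply/matrixP => i j; rewrite mulmxBl mul_scalar_mx !mxE mulr1.
    rewrite -(polar_relation_row_sum (enum_val i) rP).
    rewrite natr_sum [X in _ - X](big_enum_val (A := V)) /=; apply/eqP.
    by rewrite subr_eq0; apply/eqP/eq_bigr => l _; rewrite !mxE mulr1.
  have Bx : B *m (A - x%:M) = 0.
    rewrite /B -mulmxA (_ : (A + x%:M) *m (A - x%:M) = J) //.
    rewrite mulmxBr !mulmxDl AA !mul_mx_scalar mul_scalar_mx.
    rewrite scale_scalar_mx -expr2 xq opprD addrACA addrA.
    by apply/matrixP => i j; rewrite !mxE; ring.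
  apply/eigenvalueP; exists (row (enum_rank u) B).
    apply/eqP; rewrite -subr_eq0 -mul_mx_scalar -mulmxBr -row_mul Bx row0 //.
  apply/eqP => /rowP/(_ (enum_rank v))/eqP.
  rewrite mxE /B mulmxBl mulmxDr AA !mul_mx_scalar mul_scalar_mx.
  rewrite !mxE !enum_rankK.
  rewrite (inj_eq enum_rank_inj) (negPf uv) (negPf ruv) !mulr0n.
  by rewrite !(mulr0, add0r, addr0) subr0 oner_eq0.
exists [:: k%:R; s; - s]; split => //.
  rewrite /= !inE negb_or !kneq ?sqrrN // andbT /=.
  by rewrite -subr_eq0 opprK -mulr2n mulrn_eq0 negb_or s0.
move=> a; rewrite !inE; apply/idP/or3P.
  case/eigenvalueP => x xA x0; have [c xJ] := eJ x.
  have xq : (a ^+ 2 - q) *: x = c *: e.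
    have : x *m (A *m A) = x *m (q%:M + J) by rewrite AA.
    rewrite mulmxA xA -scalemxAl xA mulmxDr mul_mx_scalar xJ scalerA => E.
    by rewrite scalerBl expr2 E addrC addKr.
  have := congr1 (mulmx^~ A) xq.
  rewrite -!scalemxAl xA eA [c *: _]scalerA mulrC -scalerA -xq !scalerA => /eqP.
  rewrite -subr_eq0 -scalerBl scaler_eq0 (negPf x0) orbF.
  have -> : (a ^+ 2 - q) * a - k%:R * (a ^+ 2 - q)
      = (a - k%:R) * ((a - s) * (a + s)).
    by rewrite -ss; ring.
  rewrite !mulf_eq0 subr_eq0 => /orP[->|]; first by constructor 1.
  rewrite subr_eq0 addr_eq0 => /orP[->|->]; [by constructor 2|by constructor 3].
case=> /eqP->; [|exact: root_eig|by apply: root_eig; rewrite sqrrN].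
apply/eigenvalueP; exists e => //.
by apply/eqP => /rowP/(_ (enum_rank u))/eqP; rewrite !mxE oner_eq0.
Qed.

(** * The multigraph of a polar relation *)

(** Edges are their own endpoint sets, so none is repeated; a singleton is a loop, present when
    [r x x]. *)
Definition is_edge (V : finType) (r : rel V) (e : {set V}) : bool :=
  [exists x, exists y, r x y && (e == [set x; y])].

Lemma card_edge (V : finType) (r : rel V) (e : {e : {set V} | is_edge r e}) :
  (0 < #|val e| <= 2)%N.
Proof.
have /existsP[x /existsP[y /andP[_ /eqP->]]] := valP e.
by rewrite cards2; case: eqP.
Qed.

Definition graph_of_relation (V : finType) (r : rel V) : multigraph :=
  Multigraph (@card_edge V r).

Lemma multiplicity_graph_of_relation (V : finType) (r : rel V) (u v : V) :
  symmetric r -> @multiplicity (graph_of_relation r) u v = r u v.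
Proof.
move=> rC; rewrite /multiplicity; case ruv: (r u v).
  have uve : is_edge r [set u; v].
    by apply/existsP; exists u; apply/existsP; exists v; rewrite ruv /=.
  apply/eqP/cards1P; exists (Sub [set u; v] uve).
  by apply/setP => e; rewrite !inE -val_eqE.
apply/eqP; rewrite cards_eq0 -subset0; apply/subsetP => e.
rewrite !inE => /eqP eE.
have /existsP[x /existsP[y /andP[rxy]]] := valP e.
rewrite /= in eE *; rewrite eE => /eqP uvxy.
have := set21 u v; have := set22 u v; rewrite uvxy !inE.
have := set21 x y; have := set22 x y; rewrite -uvxy !inE.
move/orP => [] /eqP yE; move/orP => [] /eqP xE; rewrite yE xE in rxy *.
- by move=> /orP[]/eqP vu; rewrite vu rxy in ruv.
- by rewrite rC ruv in rxy.
- by rewrite ruv in rxy.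
- by move=> _ /orP[]/eqP uv; rewrite uv rxy in ruv.
Qed.

Lemma graph_of_polar_relation (V : finType) (k : nat) (r : rel V) (u v : V) :
  (2 <= k)%N -> polar_relation k r -> u != v -> ~~ r u v ->
  exists G : multigraph,
    [/\ #|vertex G| = (k ^ 2 - k + 1)%N, connected_multigraph G,
      regular_multigraph k G & has_distinct_eigenvalues (adjacency_matrix G) 3].
Proof.
move=> k2 rP uv ruv; have [rC nE _ rT] := rP.
pose G := graph_of_relation r.
have mE (x y : vertex G) : multiplicity x y = r x y.
  exact: multiplicity_graph_of_relation.
exists G; split=> //.
- move=> x y; have [->|] := eqVneq (x : V) y; first exact: connect0.
  (* Distinct vertices are joined by two steps through their common neighbour. *)
  move=> /rT[t [[xt yt] _]].
  by apply: (@connect_trans _ _ t); apply: connect1; rewrite /= mE ?xt // rC yt.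
- move=> x; rewrite -(polar_relation_row_sum x rP).
  by apply: eq_bigr => y _; rewrite mE.
- have -> : adjacency_matrix G = weight_mx (fun x y : V => r x y).
    by apply/matrixP => i j; rewrite !mxE mE.
  exact: polar_relation_eigenvalues k2 rP uv ruv.
Qed.

(** * From the multigraph to a polar relation *)

Lemma multiplicityC (G : multigraph) (u v : vertex G) :
  multiplicity u v = multiplicity v u.
Proof. by rewrite /multiplicity setUC. Qed.

(** Otherwise the singleton of [u] would be closed under adjacency. *)
Lemma connected_neighbor (G : multigraph) (u : vertex G) :
  connected_multigraph G -> (1 < #|vertex G|)%N ->
  exists2 v, v != u & (0 < multiplicity u v)%N.
Proof.
move=> Gconn n1; apply/exists_inP; apply: contraT => /exists_inPn uN.
have [v vu] : exists v, v != u.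
  have /card_gt0P[v] : (0 < #|predC1 u|)%N by rewrite cardC1; lia.
  by exists v.
have ucl : closed [rel x y : vertex G | (0 < multiplicity x y)%N] (pred1 u).
  move=> x y /=; rewrite !inE => xy; apply/eqP/eqP => [xu|yu].
    by subst x; apply/eqP; apply: contraTT xy => /uN.
  subst y; apply/eqP; move: xy; rewrite multiplicityC.
  by apply: contraTT => /uN.
by have := closed_connect ucl (Gconn u v); rewrite !inE eqxx (negPf vu).
Qed.

Lemma polar_relation_of_graph (G : multigraph) (k : nat) :
  (2 < k)%N -> #|vertex G| = (k ^ 2 - k + 1)%N -> connected_multigraph G ->
  regular_multigraph k G -> has_distinct_eigenvalues (adjacency_matrix G) 3 ->
  polar_relation k [rel u v : vertex G | (0 < multiplicity u v)%N].
Proof.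
move=> k2 nE Gconn Gk Geig; set w := @multiplicity G.
have wC x y : w x y = w y x by exact: multiplicityC.
have nbr u : exists2 v, v != u & (0 < w u v)%N.
  by apply: connected_neighbor => //; rewrite nE; nia.
have [u0 _] : exists u : vertex G, true.
  have /card_gt0P[u _] : (0 < #|vertex G|)%N by rewrite nE addn1.
  by exists u.
have [v0 v0u0 w0] := nbr u0.
have [v1 v1u0 w1] : exists2 v1, v1 != u0 & w u0 v1 = 0%N.
  suff: [exists (v | v != u0), w u0 v == 0%N].
    by case/exists_inP=> v vu /eqP wv; exists v.
  (* If every other vertex were adjacent to [u0], its degree would be at least k^2 - k > k. *)
  apply: contraT => /exists_inPn wN.
  have : (\sum_(v | v != u0) 1 <= \sum_v w u0 v)%N.
    rewrite [X in (_ <= X)%N](bigD1 u0) //=; apply: leq_trans (leq_addl _ _).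
    by apply: leq_sum => v /wN; lia.
  by rewrite sum1_card cardC1 nE Gk; nia.
have [a [b [c [c0 abcE]]]] := walks2_three_eigenvalues u0 wC Gk Gconn Geig.
have [p [q [l [l0 pqE]]]] :
  exists (p q : int) (l : nat), (0 < l)%N /\ forall u v,
    (w u0 v0 * walks2 w u v)%:Z
      = p * (w u v)%:Z + q * (u == v)%:Z + (w u0 v0 * l)%:Z.
  by apply: (walks2_integral_coefficients c0 abcE _ _ w1); rewrite eq_sym.
have [w_le1 S1] := walks2_design wC Gk k2 nE nbr w0 l0 pqE.
split=> //.
- by move=> x y /=; rewrite wC.
- move=> x; rewrite -(Gk x) cardsE -sum1_card big_mkcond.
  apply: eq_bigr => y _; rewrite unfold_in /= -/(w x y).
  by have := w_le1 x y; case: (w x y) => [|[]].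
- move=> u v /S1 Suv.
  have /eqP/cards1P[t tE] : #|[set t | (0 < w u t)%N && (0 < w v t)%N]| = 1%N.
    transitivity (walks2 w u v) => //; rewrite cardsE -sum1_card big_mkcond.
    apply: eq_bigr => t _.
    rewrite unfold_in (wC t v) /= -/(w u t) -/(w v t).
    have := w_le1 u t; have := w_le1 v t.
    by case: (w u t) => [|[|?]]; case: (w v t) => [|[|?]].
  exists t; split; first by have := set11 t; rewrite -tE inE => /andP.
  by move=> s [us vs]; apply/esym/set1P; rewrite -tE inE; apply/andP.
Qed.

Local Close Scope ring_scope.

Theorem theorem4p2 (k : nat) (hk : 2 <= k) :
  (exists G : multigraph,
     [/\ #|vertex G| = k ^ 2 - k + 1,
         connected_multigraph G,
         regular_multigraph k G
       & has_distinct_eigenvalues (adjacency_matrix G) 3])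
  <->
  (exists Pi : geometry, projective_plane (k - 1) Pi /\ admits_polarity Pi).
Proof.
(* At k = 2, k + 1 = k^2 - k + 1 and counting yields no nonadjacent pair; one explicit relation on
   three points proves both sides. *)
have [k2 | k_gt2] : k = 2 \/ 2 < k by lia.
  subst k; have [r [rP [u [v [uv ruv]]]]] := polar_relation_order1.
  split=> _; first exact: plane_of_polar_relation hk rP.
  exact: graph_of_polar_relation hk rP uv ruv.
split=> [[G [nE Gconn Gk Geig]]|[Pi [PiP PiPol]]].
  have rP := polar_relation_of_graph k_gt2 nE Gconn Gk Geig.
  exact: plane_of_polar_relation hk rP.
have [r rP] := polar_relation_of_plane hk PiP PiPol.
have [u [v [uv ruv]]] := polar_relation_nonadjacent k_gt2 rP.
exact: graph_of_polar_relation hk rP uv ruv.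
Qed.
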